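(* Let $0<\alpha<1$. For $\theta=1-\alpha$ and $\theta=2-\alpha$, the symmetrized splitting rules are the same, i.e. $q^{\mathrm{sym}}_{\alpha,1-\alpha}(x,y)=q^{\mathrm{sym}}_{\alpha,2-\alpha}(x,y)$ for all integers $x,y\ge1$. Therefore, the $(\alpha,2-\alpha)$-tree growth process is weakly sampling consistent.
   Context: Splitting rules. With $[x]_k=x(x+1)\cdots(x+k-1)$, $[x]_0=1$, let $$q_{\alpha,\theta}(n,m)=\binom nm\frac{n\alpha-m\alpha+m\theta}{n}\,\frac{[1-\alpha]_{m-1}}{[n-m+\theta]_m},\quad 1\le m\le n,$$ $q^{\mathrm{bias}}_{\alpha,\theta}(x,y)=q_{\alpha,\theta}(x+y-1,x)$ for $x,y\ge1$ (the probability that the first split of $T_{x+y}$ below is into subtrees with $x$ and $y$ leaves, the subtree with $x$ leaves not containing label 1), and $q^{\mathrm{sym}}_{\alpha,\theta}(x,y)=\frac12q^{\mathrm{bias}}_{\alpha,\theta}(x,y)+\frac12q^{\mathrm{bias}}_{\alpha,\theta}(y,x)$. Trees. Rooted binary trees with leaves labeled by $[n]=\{1,\dots,n\}$ have root and leaves of degree 1 and all other vertices (branch points) of degree 3. The root edge is the edge adjacent to the root. For $n\ge2$ a tree splits at the branch point adjacent to the root into two subtrees, each rooted at that branch point (so each subtree has its own root edge, starting there). $(\alpha,\theta)$-tree growth process. $T_1$ is a single edge joining the root and leaf 1; $T_2$ is the Y-shaped tree with leaves 1, 2. For $n\ge2$, given $T_1,\dots,T_n$, an edge $a_n\to c_n$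 of $T_n$ (directed away from the root) is selected at random and replaced by three edges $a_n\to b_n$, $b_n\to c_n$, $b_n\to n+1$ with a new branch point $b_n$ and a new leaf $n+1$, giving $T_{n+1}$. Selection rule: let the two subtrees above the branch point adjacent to the root have $m$ and $n-m$ leaves, the latter containing the smallest label. Choose the root edge, the first or the second subtree with probabilities proportional to $\alpha$, $m-\alpha$, $n-m-1+\theta$. If a subtree with at least two leaves was chosen, apply the procedure recursively to it (with its own root edge, number of leaves and smallest label), until a root edge or a single-leaf subtree is chosen; in the latter case its unique edge is selected. Weak sampling consistency. Let $T_n^\circ$ be $T_n$ with leaf labels removed and let $\widehat T_n^\circ$ be obtained from $T_{n+1}^\circ$ by removing a uniformly chosen leaf (with its edge, suppressing the resulting degree-2 vertex). The process is weakly sampling consistent if $T_n^\circ\overset d=\widehat T_n^\circ$ for all $n\ge1$. *)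

(* Defs.v *)
From mathcomp Require Import all_boot all_order all_algebra.
From mathcomp Require Import reals.

Set Implicit Arguments.
Unset Strict Implicit.
Unset Printing Implicit Defensive.

Import Order.TTheory GRing.Theory Num.Theory.
Local Open Scope ring_scope.

Definition rising (R : realFieldType) (x : R) (k : nat) : R :=
  \prod_(i < k) (x + i%:R).

Definition q (R : realFieldType) (alpha theta : R) (n m : nat) : R :=
  'C(n, m)%:R
  * ((n%:R * alpha - m%:R * alpha + m%:R * theta) / n%:R)
  * (rising (1 - alpha) m.-1 / rising (n%:R - m%:R + theta) m).

Definition q_bias (R : realFieldType) (alpha theta : R) (x y : nat) : R :=
  q alpha theta (x + y).-1 x.

Definition q_sym (R : realFieldType) (alpha theta : R) (x y : nat) : R :=
  2^-1 * q_bias alpha theta x y + 2^-1 * q_bias alpha theta y x.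

(* A value stands for a tree together with its root edge: [Leaf a] is a single
   edge from the root to a leaf, and [Node l r] is a root edge leading to a
   branch point at which the subtrees [l] and [r] are rooted.  The trees are not
   planar: the order of the two arguments of [Node] has no meaning, and trees
   are only ever compared up to [isom] below. *)
Inductive btree (A : Type) : Type :=
| Leaf of A
| Node of btree A & btree A.

Definition ltree := btree nat.
Definition shape := btree unit.

Fixpoint nleaves (A : Type) (t : btree A) : nat :=
  match t with
  | Leaf _ => 1
  | Node l r => nleaves l + nleaves r
  end.

Fixpoint min_label (t : ltree) : nat :=
  match t with
  | Leaf i => i
  | Node l r => minn (min_label l) (min_label r)
  end.

Fixpoint unlabel (A : Type) (t : btree A) : shape :=
  match t with
  | Leaf _ => Leaf tt
  | Node l r => Node (unlabel l) (unlabel r)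
  end.

Fixpoint isom (s t : shape) : bool :=
  match s, t with
  | Leaf _, Leaf _ => true
  | Node a b, Node c d => isom a c && isom b d || isom a d && isom b c
  | _, _ => false
  end.

(* The trees obtained by deleting one leaf and its edge, one entry per leaf:
   once the branch point next to the deleted leaf is suppressed, the sibling
   subtree takes its place.  A one-leaf tree has no such deletion. *)
Fixpoint deletions (A : Type) (t : btree A) : seq (btree A) :=
  match t with
  | Leaf _ => [::]
  | Node l r =>
      (if l is Leaf _ then [:: r] else [seq Node l' r | l' <- deletions l]) ++
      (if r is Leaf _ then [:: l] else [seq Node l r' | r' <- deletions r])
  end.

(* A law is a list of outcomes with their weights; an outcome may be repeated,
   in which case its weights add up. *)
Definition law (R : realFieldType) (A : Type) := seq (R * A).

Definition prob (R : realFieldType) (A : Type) (d : law R A) (E : pred A) : R :=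
  \sum_(wa <- d | E wa.2) wa.1.

Definition dirac (R : realFieldType) (A : Type) (a : A) : law R A := [:: (1, a)].

Definition law_bind (R : realFieldType) (A B : Type)
    (d : law R A) (k : A -> law R B) : law R B :=
  flatten [seq [seq (wa.1 * wb.1, wb.2) | wb <- k wa.2] | wa <- d].

Definition law_map (R : realFieldType) (A B : Type) (f : A -> B)
    (d : law R A) : law R B :=
  [seq (wa.1, f wa.2) | wa <- d].

Definition uniform_law (R : realFieldType) (A : Type) (s : seq A) : law R A :=
  [seq ((size s)%:R^-1, a) | a <- s].

(* Choose a branch with probability proportional to its weight, then draw from
   the law attached to that branch. *)
Definition choose_prop (R : realFieldType) (A : Type) (s : seq (R * law R A)) :
    law R A :=
  law_bind [seq (wd.1 / (\sum_(wd' <- s) wd'.1), wd.2) | wd <- s] id.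

Definition shape_law_eq (R : realFieldType) (d1 d2 : law R shape) : Prop :=
  forall s : shape, prob d1 (isom s) = prob d2 (isom s).

Definition subtree_weight (R : realFieldType) (alpha theta : R)
    (t sibling : ltree) : R :=
  if (min_label t < min_label sibling)%N then (nleaves t)%:R - 1 + theta
  else (nleaves t)%:R - alpha.

(* Law of the tree obtained from [t] by inserting the leaf [x] into an edge
   picked by the recursive selection rule. *)
Fixpoint grow (R : realFieldType) (alpha theta : R) (x : nat) (t : ltree) :
    law R ltree :=
  match t with
  | Leaf _ => dirac R (Node t (Leaf x))
  | Node l r =>
      choose_prop
        [:: (alpha, dirac R (Node t (Leaf x)));
            (subtree_weight alpha theta l r,
             law_map (fun l' => Node l' r) (grow alpha theta x l));
            (subtree_weight alpha theta r l,
             law_map (fun r' => Node l r') (grow alpha theta x r))]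
  end.

Definition next_tree (R : realFieldType) (alpha theta : R) (x : nat)
    (h : seq ltree) : law R ltree :=
  if h is t :: _ then grow alpha theta x t else dirac R (Leaf 1%N).

(* Joint law of [:: T_n; ...; T_1], most recent tree first. *)
Fixpoint growth_process (R : realFieldType) (alpha theta : R) (n : nat) :
    law R (seq ltree) :=
  if n is n'.+1 then
    law_bind (growth_process alpha theta n') (fun h =>
      law_map (fun t => t :: h) (next_tree alpha theta n h))
  else dirac R [::].

(* Law of T_n, for [1 <= n]. *)
Definition tree_law (R : realFieldType) (alpha theta : R) (n : nat) :
    law R ltree :=
  law_map (head (Leaf 1%N)) (growth_process alpha theta n).

Definition unlabelled_law (R : realFieldType) (alpha theta : R) (n : nat) :
    law R shape :=
  law_map (@unlabel nat) (tree_law alpha theta n).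

Definition leaf_deleted_law (R : realFieldType) (alpha theta : R) (n : nat) :
    law R shape :=
  law_bind (unlabelled_law alpha theta n.+1) (fun s =>
    uniform_law R (deletions s)).

Definition weakly_sampling_consistent (R : realFieldType) (alpha theta : R) :
    Prop :=
  forall n : nat, (1 <= n)%N ->
    shape_law_eq (unlabelled_law alpha theta n) (leaf_deleted_law alpha theta n).

(* Main.v *)
Require Import Defs.
From mathcomp Require Import all_boot all_order all_algebra.
From mathcomp Require Import reals.
From mathcomp Require Import zify ring lra.
(* [shape] also names an operation on sequences; this makes it mean unlabelled
   trees again. *)
Import Defs.

(** Why the theorem holds.

    New leaves always carry the largest label, so in a grown tree the subtree
    containing the smaller label is always the left argument of [Node].  The
    selection rule looks at labels only through this comparison, so the
    unlabelled planar tree is itself a Markov chain, driven by [grow_shape].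

    This chain has the branching property ([first_split]): its first split is
    into a left subtree with [y] leaves and a right one with [x] leaves with
    probability [q_bias x y], and given the sizes the two subtrees are
    independent copies of the chain.  Induction on the number of leaves reduces
    this to a linear recursion for [q_bias] in the two sizes ([q_bias_step]).

    For functions of the shape that ignore the order of subtrees, [q_bias] may
    be replaced by [q_sym].  Deleting a uniform leaf acts inside one of the two
    subtrees, or leaves only the sibling of a one-leaf subtree; with the
    branching property, induction gives sampling consistency as soon as [q_sym]
    satisfies the algebraic identity [deletion_stable]
    ([deletion_stable_consistent]).

    At [theta = 1 - alpha] and at [theta = 2 - alpha] all rising factorials are
    expressible through those of [1 - alpha], and both rules [q_sym] simplify to
    the splitting rule [ford_split] of Ford's alpha model, which satisfies that
    identity ([ford_split_deletion]). *)

Import Order.TTheory GRing.Theory Num.Theory.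
Local Open Scope ring_scope.
Set Implicit Arguments.
Unset Strict Implicit.
Unset Printing Implicit Defensive.

(** * Expectations and supports of weighted lists *)

Section Expectation.
Variable R : realFieldType.
Implicit Types A B : Type.

Definition expect {A} (d : law R A) (f : A -> R) : R :=
  \sum_(wa <- d) wa.1 * f wa.2.

Definition supported {A} (p : pred A) (d : law R A) : bool :=
  all (fun wa => p wa.2) d.

Lemma prob_expect A (d : law R A) (E : pred A) :
  prob d E = expect d (fun a => (E a)%:R).
Proof.
rewrite /prob /expect big_mkcond; apply: eq_bigr => wa _.
by case: (E wa.2); rewrite ?mulr1 ?mulr0.
Qed.

Lemma expect_dirac A (a : A) f : expect (dirac R a) f = f a.
Proof. by rewrite /expect big_seq1 mul1r. Qed.

Lemma expect_map A B (h : A -> B) (d : law R A) f :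
  expect (law_map h d) f = expect d (f \o h).
Proof. by rewrite /expect big_map. Qed.

Lemma expect_bind A B (d : law R A) (k : A -> law R B) f :
  expect (law_bind d k) f = expect d (fun a => expect (k a) f).
Proof.
rewrite /expect big_flatten big_map; apply: eq_bigr => wa _.
by rewrite big_map big_distrr; apply: eq_bigr => wb _; rewrite /= mulrA.
Qed.

Lemma expect_choose A (s : seq (R * law R A)) f :
  expect (choose_prop s) f =
  (\sum_(wd <- s) wd.1 * expect wd.2 f) / \sum_(wd <- s) wd.1.
Proof.
rewrite expect_bind {1}/expect big_map big_distrl.
by apply: eq_bigr => wd _; rewrite /= mulrAC.
Qed.

Lemma expect_uniform A (s : seq A) f :
  expect (uniform_law R s) f = (size s)%:R^-1 * \sum_(a <- s) f a.
Proof. by rewrite /expect big_map big_distrr. Qed.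

Lemma eq_expect A (d : law R A) f g : f =1 g -> expect d f = expect d g.
Proof. by move=> fg; apply: eq_bigr => wa _; rewrite fg. Qed.

Lemma eq_expect_in A (p : pred A) (d : law R A) f g :
  supported p d -> (forall a, p a -> f a = g a) -> expect d f = expect d g.
Proof.
rewrite /expect; elim: d => [|[w a] d IHd] /=; first by rewrite !big_nil.
by case/andP=> pa pd fg; rewrite !big_cons /= fg // IHd.
Qed.

Lemma expectD A (d : law R A) f g :
  expect d (fun a => f a + g a) = expect d f + expect d g.
Proof. by rewrite -big_split; apply: eq_bigr => wa _; rewrite mulrDr. Qed.

Lemma expectZ A (d : law R A) c f :
  expect d (fun a => c * f a) = c * expect d f.
Proof. by rewrite big_distrr; apply: eq_bigr => wa _; rewrite /= mulrCA. Qed.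

Lemma expectC A B (d : law R A) (e : law R B) (f : A -> B -> R) :
  expect d (fun a => expect e (f a)) =
  expect e (fun b => expect d (f^~ b)).
Proof.
transitivity (\sum_(wa <- d) \sum_(wb <- e) wa.1 * (wb.1 * f wa.2 wb.2)).
  by apply: eq_bigr => wa _; rewrite big_distrr.
rewrite exchange_big; apply: eq_bigr => wb _.
by rewrite big_distrr; apply: eq_bigr => wa _; rewrite /= mulrCA.
Qed.

Lemma law_map_comp A B C (g : B -> C) (h : A -> B) (d : law R A) :
  law_map g (law_map h d) = law_map (g \o h) d.
Proof. by rewrite /law_map -map_comp. Qed.

Lemma law_map_bind A B C (g : B -> C) (d : law R A) (k : A -> law R B) :
  law_map g (law_bind d k) = law_bind d (fun a => law_map g (k a)).
Proof.
rewrite /law_map /law_bind map_flatten -map_comp; congr flatten.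
by apply: eq_map => wa /=; rewrite -!map_comp.
Qed.

Lemma law_bind_map A B C (h : A -> B) (d : law R A) (k : B -> law R C) :
  law_bind (law_map h d) k = law_bind d (k \o h).
Proof. by rewrite /law_bind /law_map -map_comp. Qed.

Lemma eq_law_bind_in A B (p : pred A) (d : law R A) (k k' : A -> law R B) :
  supported p d -> (forall a, p a -> k a = k' a) ->
  law_bind d k = law_bind d k'.
Proof.
rewrite /law_bind; elim: d => //= [[w a] d] IHd /andP[/= pa pd] kk'.
by rewrite kk' // IHd.
Qed.

Lemma law_map_choose A B (g : A -> B) (s : seq (R * law R A)) :
  law_map g (choose_prop s) =
  choose_prop [seq (wd.1, law_map g wd.2) | wd <- s].
Proof.
rewrite /choose_prop law_map_bind /law_bind big_map /= -!map_comp.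
by congr flatten; apply: eq_map.
Qed.

Lemma supported_map A B (p : pred B) (h : A -> B) (d : law R A) :
  supported p (law_map h d) = supported (p \o h) d.
Proof. by rewrite /supported all_map. Qed.

Lemma supported_bind A B (p : pred A) (p' : pred B) (d : law R A) k :
  supported p d -> (forall a, p a -> supported p' (k a)) ->
  supported p' (law_bind d k).
Proof.
rewrite /supported /law_bind => pd pk; elim: d pd => //= wa d IHd /andP[pa pd].
by rewrite all_cat IHd // all_map andbT; apply: pk.
Qed.

Lemma supported_choose A (p : pred A) (s : seq (R * law R A)) :
  all (fun wd => supported p wd.2) s -> supported p (choose_prop s).
Proof.
move=> ps; apply: (@supported_bind _ _ (supported p)) => //.
by rewrite /supported all_map.
Qed.

Lemma sub_supported A (p p' : pred A) (d : law R A) :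
  (forall a, p a -> p' a) -> supported p d -> supported p' d.
Proof. by move=> pp'; apply: sub_all => wa; apply: pp'. Qed.

End Expectation.

(** * The chain of unlabelled shapes *)

#[local] Arguments choose_prop : simpl never.
#[local] Arguments supported : simpl never.
#[local] Arguments law_map : simpl never.
#[local] Arguments law_bind : simpl never.

Section Shapes.
Variables (R : realFieldType) (alpha theta : R).

(** The growth rule with the position in [Node] standing for the labels: the
    left subtree is always the one containing the smaller label. *)
Fixpoint grow_shape (t : shape) : law R shape :=
  match t with
  | Leaf _ => @dirac R shape (Node t (Leaf tt))
  | Node l r =>
      choose_prop
        [:: (alpha, @dirac R shape (Node t (Leaf tt)));
            ((nleaves l)%:R - 1 + theta,
             law_map (fun l' => Node l' r) (grow_shape l));
            ((nleaves r)%:R - alpha,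
             law_map (fun r' => Node l r') (grow_shape r))]
  end.

(** Indexed so that [shape_law n] lives on shapes with [n.+1] leaves. *)
Fixpoint shape_law (n : nat) : law R shape :=
  if n is n'.+1 then law_bind (shape_law n') grow_shape
  else @dirac R shape (Leaf tt).

(** The invariant of grown trees that lets [grow_shape] forget the labels. *)
Fixpoint increasing (t : ltree) : bool :=
  if t is Node l r then
    [&& increasing l, increasing r & (min_label l < min_label r)%N]
  else true.

Fixpoint labels_below (x : nat) (t : ltree) : bool :=
  match t with
  | Leaf i => (i < x)%N
  | Node l r => labels_below x l && labels_below x r
  end.

Lemma min_label_below x t : labels_below x t -> (min_label t < x)%N.
Proof.
by elim: t => //= l IHl r IHr /andP[/IHl lx _]; rewrite gtn_min lx.
Qed.

Lemma labels_belowS x t : labels_below x t -> labels_below x.+1 t.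
Proof.
elim: t => [i|l IHl r IHr] /=; first exact: ltnW.
by case/andP=> /IHl -> /IHr ->.
Qed.

Lemma nleaves_unlabel (t : ltree) : nleaves (unlabel t) = nleaves t.
Proof. by elim: t => //= l -> r ->. Qed.

(** The laws are equal as lists: for an increasing tree, [subtree_weight] gives
    the left subtree the theta weight and the right one the alpha weight, as
    [grow_shape] does. *)
Lemma unlabel_grow x t : increasing t -> labels_below x t ->
  law_map (@unlabel nat) (grow alpha theta x t) = grow_shape (unlabel t).
Proof.
elim: t => [i|l IHl r IHr] //= /and3P[incl incr ltlr] /andP[bl br].
rewrite law_map_choose /= !law_map_comp.
rewrite -(IHl incl bl) -(IHr incr br) !law_map_comp !nleaves_unlabel.
by rewrite /subtree_weight ltlr ltnNge (ltnW ltlr).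
Qed.

(** The new label exceeds all others, so no minimum changes, and the new leaf is
    attached on the right of what it is grafted to. *)
Lemma grow_increasing x t : increasing t -> labels_below x t ->
  supported (fun t' => [&& increasing t', labels_below x.+1 t' &
                          min_label t' == min_label t]) (grow alpha theta x t).
Proof.
have attach (u : ltree) : increasing u -> labels_below x u ->
    [&& increasing (Node u (Leaf x)), labels_below x.+1 (Node u (Leaf x)) &
        min_label (Node u (Leaf x)) == min_label u].
  move=> incu bu /=; have ux := min_label_below bu.
  by rewrite incu ux labels_belowS //= leqnn (minn_idPl (ltnW ux)) eqxx.
elim: t => [i|l IHl r IHr] inct bt.
  by apply/andP; split=> //; exact: attach.
have /= /and3P[incl incr ltlr] := inct; have /= /andP[bl br] := bt.
rewrite /=; apply: supported_choose; rewrite /= !supported_map.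
apply/and4P; split=> //.
- by apply/andP; split=> //; exact: attach.
- apply: sub_supported (IHl incl bl) => l' /= /and3P[-> -> /eqP ->].
  by rewrite incr ltlr labels_belowS // eqxx.
- apply: sub_supported (IHr incr br) => r' /= /and3P[-> -> /eqP ->].
  by rewrite incl ltlr labels_belowS // eqxx.
Qed.

Lemma growth_process_increasing n :
  supported (fun h => if h is t :: _ then increasing t && labels_below n.+2 t
                      else false)
    (growth_process alpha theta n.+1).
Proof.
elim: n => [//|n IHn].
apply: supported_bind IHn _ => -[//|t h] /andP[inct bt].
rewrite supported_map.
by apply: sub_supported (grow_increasing inct bt) => t' /= /and3P[-> ->].
Qed.

Lemma unlabelled_law_shape n :
  unlabelled_law alpha theta n.+1 = shape_law n.
Proof.
rewrite /unlabelled_law /tree_law law_map_comp.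
elim: n => [|n IHn]; first by rewrite /= /law_bind /law_map /dirac /= mul1r.
rewrite [shape_law _]/= -IHn law_bind_map.
rewrite [growth_process _ _ n.+2]/= -/(growth_process alpha theta n.+1).
rewrite law_map_bind.
apply: eq_law_bind_in (growth_process_increasing n) _ => -[//|t h].
by case/andP=> inct bt; rewrite law_map_comp; exact: unlabel_grow.
Qed.

Lemma nleaves_grow_shape s :
  supported (fun t => nleaves t == (nleaves s).+1) (grow_shape s).
Proof.
elim: s => [[]|l IHl r IHr] //.
rewrite /=; apply: supported_choose; rewrite /= !supported_map.
apply/and4P; split=> //.
- by rewrite /supported /= addn1 eqxx.
- by apply: sub_supported IHl => l' /= /eqP ->.
- by apply: sub_supported IHr => l' /= /eqP ->; rewrite addnS.
Qed.

Lemma nleaves_shape_law n :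
  supported (fun s => nleaves s == n.+1) (shape_law n).
Proof.
elim: n => //= n IHn; apply: supported_bind IHn _ => s /eqP <-.
exact: nleaves_grow_shape.
Qed.

Lemma eq_expect_shape n f g : (forall s, nleaves s = n.+1 -> f s = g s) ->
  expect (shape_law n) f = expect (shape_law n) g.
Proof.
move=> fg; apply: eq_expect_in (nleaves_shape_law n) _ => s /eqP.
exact: fg.
Qed.

Lemma expect_shape_lawS n f : expect (shape_law n.+1) f =
  expect (shape_law n) (fun s => expect (grow_shape s) f).
Proof. exact: expect_bind. Qed.

Lemma expect_grow_node l r f :
  expect (grow_shape (Node l r)) f =
  (alpha * f (Node (Node l r) (Leaf tt)) +
   (((nleaves l)%:R - 1 + theta) *
      expect (grow_shape l) (fun l' => f (Node l' r)) +
    ((nleaves r)%:R - alpha) *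
      expect (grow_shape r) (fun r' => f (Node l r')))) /
  ((nleaves l + nleaves r)%:R - 1 + theta).
Proof.
rewrite expect_choose !big_cons !big_nil !expect_map expect_dirac /= !addr0.
by congr (_ / _); rewrite natrD; ring.
Qed.

End Shapes.

(** * Sums over the sizes of two subtrees *)

Section Antidiagonal.
Variable R : realFieldType.

(** Sizes are positive, so the sizes [i.+1] and [j.+1] of two subtrees with
    [m.+2] leaves in total are indexed by [i + j = m]. *)
Definition adsum (m : nat) (F : nat -> nat -> R) : R :=
  \sum_(i < m.+1) F i (m - i)%N.

Lemma eq_adsum m F G : (forall i j, (i + j)%N = m -> F i j = G i j) ->
  adsum m F = adsum m G.
Proof.
by move=> FG; apply: eq_bigr => i _; apply: FG; rewrite subnKC // -ltnS.
Qed.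

Lemma adsumSl m F :
  adsum m.+1 F = F 0%N m.+1 + adsum m (fun i j => F i.+1 j).
Proof. by rewrite /adsum big_ord_recl subn0. Qed.

Lemma adsumSr m F :
  adsum m.+1 F = adsum m (fun i j => F i j.+1) + F m.+1 0%N.
Proof.
rewrite /adsum big_ord_recr /= subnn; congr (_ + _).
by apply: eq_bigr => i _; rewrite subSn // -ltnS.
Qed.

Lemma adsumC m F : adsum m F = adsum m (fun i j => F j i).
Proof.
rewrite /adsum (reindex_inj rev_ord_inj); apply: eq_bigr => i _ /=.
by rewrite subSS subKn // -ltnS.
Qed.

Lemma adsumD m F G :
  adsum m (fun i j => F i j + G i j) = adsum m F + adsum m G.
Proof. exact: big_split. Qed.

Lemma adsumZ m c F : adsum m (fun i j => c * F i j) = c * adsum m F.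
Proof. by rewrite /adsum big_distrr. Qed.

End Antidiagonal.

(** * Algebra of the splitting rules *)

Section Splitting.
Variable R : realFieldType.
Implicit Types alpha theta x : R.

Lemma rising0 x : rising x 0 = 1.
Proof. by rewrite /rising big_ord0. Qed.

Lemma risingS x k : rising x k.+1 = rising x k * (x + k%:R).
Proof. by rewrite /rising big_ord_recr. Qed.

Lemma risingSl x k : rising x k.+1 = x * rising (x + 1) k.
Proof.
rewrite /rising big_ord_recl addr0; congr (_ * _); apply: eq_bigr => i _.
by rewrite /= /bump /= natrD addrA.
Qed.

Lemma rising_add x j k : rising x (j + k) = rising x j * rising (j%:R + x) k.
Proof.
elim: k => [|k IHk]; first by rewrite addn0 rising0 mulr1.
by rewrite addnS !risingS IHk natrD -mulrA; congr (_ * (_ * _)); ring.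
Qed.

Lemma rising_gt0 x k : 0 < x -> 0 < rising x k.
Proof. by move=> x0; apply: prodr_gt0 => i _; rewrite ltr_wpDr. Qed.

(** The factor [rising theta j] completes the denominator
    [(j + theta) .. (i + j + theta)] to [rising theta (i + j).+1], which depends
    on the sum of the sizes only. *)
Lemma q_biasE alpha theta i j : 0 < theta ->
  q_bias alpha theta i.+1 j.+1 =
  (i + j)`!%:R / ((i.+1)`!%:R * j`!%:R) *
  (j%:R * alpha + i.+1%:R * theta) *
  (rising (1 - alpha) i * rising theta j / rising theta (i + j).+1).
Proof.
move=> th0.
rewrite /q_bias /q /= addnS /=.
have f1 : (i.+1)`!%:R != 0 :> R by rewrite pnatr_eq0 -lt0n fact_gt0.
have f2 : j`!%:R != 0 :> R by rewrite pnatr_eq0 -lt0n fact_gt0.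
have f3 : (i + j).+1%:R != 0 :> R by rewrite pnatr_eq0.
have bE : 'C((i + j).+1, i.+1)%:R =
    (i + j).+1%:R * (i + j)`!%:R / ((i.+1)`!%:R * j`!%:R) :> R.
  apply: (canRL (mulfK (mulf_neq0 f1 f2))); rewrite -!natrM -factS.
  by rewrite -(@bin_fact (i + j).+1 i.+1) ?ltnS ?leq_addr // subSS addKn.
have rE : rising theta (i + j).+1 = rising theta j * rising (j%:R + theta) i.+1.
  by rewrite -rising_add; congr rising; lia.
have -> : (i + j).+1%:R - i.+1%:R = j%:R :> R by rewrite -addSn natrD; ring.
rewrite bE rE.
have r1 : rising theta j != 0 by rewrite gt_eqF ?rising_gt0.
have r2 : rising (j%:R + theta) i.+1 != 0.
  by rewrite gt_eqF // rising_gt0 // ltr_wpDl.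
have nE : (i + j).+1%:R = i.+1%:R + j%:R :> R by rewrite -addSn natrD.
have -> : (i + j).+1%:R * alpha - i.+1%:R * alpha + i.+1%:R * theta =
  j%:R * alpha + i.+1%:R * theta by rewrite nE; ring.
by field; rewrite r2 r1 f2 f1 -natrD nat1r f3.
Qed.

Lemma q_bias11 alpha theta : 0 < theta -> q_bias alpha theta 1 1 = 1.
Proof.
move=> th0; rewrite q_biasE // !rising0 risingS rising0 /=.
rewrite addn0 factS fact0 muln1 addr0; by field; rewrite ?gt_eqF.
Qed.

(** This is how the law of the first split evolves when a leaf is added to a
    tree with [i + j + 1] leaves.  The last leaf went to the right subtree
    (weight [i - alpha]), to the left one (weight [j - 1 + theta]) or, when
    [i = 0], to the root edge, where it makes a new one-leaf right subtree
    (weight [alpha]). *)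
Lemma q_bias_step alpha theta i j : 0 < theta -> (0 < i + j)%N ->
  ((i + j)%:R + theta) * q_bias alpha theta i.+1 j.+1 =
  (if i is i'.+1 then q_bias alpha theta i'.+1 j.+1 * (i%:R - alpha)
   else alpha) +
  (if j is j'.+1 then q_bias alpha theta i.+1 j'.+1 * (j'%:R + theta) else 0).
Proof.
move=> th0 ij0.
have f0 k : 0 < k`!%:R :> R by rewrite ltr0n fact_gt0.
have r0 k : 0 < rising theta k by exact: rising_gt0.
case: i ij0 => [|i] ij0; case: j ij0 => [|j] //= _; rewrite !q_biasE //.
- have hj := ler0n R j; rewrite !add0n !rising0 !factS !risingS !natrM !fact0.
  by field; rewrite !lt0r_neq0 ?f0 ?r0 //; lra.
- have hi := ler0n R i; rewrite !addn0 !rising0 !factS !risingS !natrM !fact0.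
  by field; rewrite !lt0r_neq0 ?f0 ?r0 //; lra.
- have hi := ler0n R i; have hj := ler0n R j.
  rewrite !addSn !addnS !factS !risingS !natrM.
  by field; rewrite !lt0r_neq0 ?f0 ?r0 //; lra.
Qed.

(** The symmetrized splitting rule of Ford's alpha model, for subtrees with
    [i.+1] and [j.+1] leaves. *)
Definition ford_split alpha i j : R :=
  (i + j)`!%:R / (2 * ((i.+1)`!%:R * (j.+1)`!%:R)) *
  (rising (1 - alpha) i * rising (1 - alpha) j
   / rising (1 - alpha) (i + j).+1) *
  (alpha * ((i + j).+2%:R * (i + j).+1%:R) +
   2 * i.+1%:R * j.+1%:R * (1 - 2 * alpha)).

Lemma q_sym_one_sub alpha i j : alpha < 1 ->
  q_sym alpha (1 - alpha) i.+1 j.+1 = ford_split alpha i j.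
Proof.
move=> a1; have th0 : 0 < 1 - alpha by lra.
have f0 k : 0 < k`!%:R :> R by rewrite ltr0n fact_gt0.
have r0 k : 0 < rising (1 - alpha) k by exact: rising_gt0.
have hi := ler0n R i; have hj := ler0n R j.
rewrite /q_sym !q_biasE // (addnC j i) /ford_split !factS !natrM.
by field; rewrite !lt0r_neq0 ?f0 ?r0 //; lra.
Qed.

(** [rising (2 - alpha) k] is [rising (1 - alpha) k.+1] without its first
    factor, so the biased rule is the one for [theta = 1 - alpha] up to a factor
    rational in the sizes; the difference of the two biased rules is
    antisymmetric in the sizes and disappears under symmetrization. *)
Lemma q_sym_two_sub alpha i j : alpha < 1 ->
  q_sym alpha (2 - alpha) i.+1 j.+1 = ford_split alpha i j.
Proof.
move=> a1; have th0 : 0 < 1 - alpha by lra.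
have f0 k : 0 < k`!%:R :> R by rewrite ltr0n fact_gt0.
have r0 k : 0 < rising (1 - alpha) k by exact: rising_gt0.
have hi := ler0n R i; have hj := ler0n R j.
have shift k : rising (2 - alpha) k =
    rising (1 - alpha) k * (1 - alpha + k%:R) / (1 - alpha).
  rewrite -risingS risingSl mulrC mulKf ?gt_eqF //.
  by congr rising; ring.
rewrite /q_sym !q_biasE ?(addnC j i); [|lra..].
rewrite /ford_split !shift !factS !natrM !risingS.
by field; rewrite !lt0r_neq0 ?f0 ?r0 //; lra.
Qed.

(** With [x = i.+1], [y = j.+1], [n = x + y] and
    [G x y = alpha * n * (n - 1) + 2 * x * y * (1 - 2 * alpha)], where [n] stands
    for the sum of the arguments of [G], the common factors cancel and leave
    [(x - alpha) * G (x + 1) y + (y - alpha) * G x (y + 1)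
       = (n + 2 - 2 * alpha) * G x y]. *)
Lemma ford_split_deletion alpha i j : alpha < 1 ->
  i.+2%:R * ford_split alpha i.+1 j + j.+2%:R * ford_split alpha i j.+1 =
  ((i + j).+3%:R - 2 * ford_split alpha 0 (i + j).+1) * ford_split alpha i j.
Proof.
move=> a1; have th0 : 0 < 1 - alpha by lra.
have f0 k : 0 < k`!%:R :> R by rewrite ltr0n fact_gt0.
have r0 k : 0 < rising (1 - alpha) k by exact: rising_gt0.
have hi := ler0n R i; have hj := ler0n R j.
rewrite /ford_split !addnS !addSn add0n !factS !natrM fact0 rising0 !risingS.
by field; rewrite !lt0r_neq0 ?f0 ?r0 //; lra.
Qed.

End Splitting.

(** * The branching property *)

Section FirstSplit.
Variables (R : realFieldType) (alpha theta : R).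
Hypothesis theta_gt0 : 0 < theta.
Implicit Types f : shape -> R.

Local Notation E n := (expect (shape_law alpha theta n)).

(** One growth step either makes the whole tree the left subtree of a new root
    branch point, or is a growth step inside the left or the right subtree,
    which by the induction hypothesis are independent copies of the chain; in
    each case the result is again a pair of independent copies. *)
Theorem first_split m f :
  E m.+1 f = adsum m (fun i j => q_bias alpha theta i.+1 j.+1 *
                                 E j (fun l => E i (fun r => f (Node l r)))).
Proof.
elim: m f => [|m IHm] f.
  rewrite expect_shape_lawS /adsum big_ord1 q_bias11 // mul1r /=.
  by rewrite !expect_dirac.
pose H i j := E j (fun l => E i (fun r => f (Node l r))).
pose b i j := q_bias alpha theta i.+1 j.+1.
have N0 : m.+1%:R + theta != 0 by rewrite gt_eqF // ltr_wpDl.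
(* The effect of one growth step on a tree whose first split is [(i, j)]. *)
have grow_split i j : (i + j)%N = m ->
    E j (fun l => E i (fun r =>
      expect (grow_shape alpha theta (Node l r)) f)) =
    (m.+1%:R + theta)^-1 *
      (alpha * E j (fun l => E i (fun r => f (Node (Node l r) (Leaf tt)))) +
       ((j%:R + theta) * H i j.+1 + (i.+1%:R - alpha) * H i.+1 j)).
  move=> ijm.
  transitivity (E j (fun l => E i (fun r => (m.+1%:R + theta)^-1 *
      (alpha * f (Node (Node l r) (Leaf tt)) +
       ((j%:R + theta) *
          expect (grow_shape alpha theta l) (fun l' => f (Node l' r)) +
        (i.+1%:R - alpha) *
          expect (grow_shape alpha theta r) (fun r' => f (Node l r'))))))).
    apply: eq_expect_shape => l lj; apply: eq_expect_shape => r ri.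
    rewrite expect_grow_node lj ri mulrC -ijm.
    congr (_^-1 * (_ + (_ * _ + _))); rewrite -?natr1 ?natrD -?natr1; ring.
  under eq_expect => l.
    rewrite expectZ expectD expectZ expectD !expectZ.
    rewrite (expectC _ (grow_shape _ _ l)).
    over.
  rewrite expectZ expectD expectZ expectD !expectZ.
  rewrite /H expect_shape_lawS; congr (_ * (_ + (_ + _ * _))).
  by apply: eq_expect => l; rewrite expect_shape_lawS.
rewrite expect_shape_lawS IHm.
(* Expand the right-hand side by the recursion for the splitting rule. *)
transitivity ((m.+1%:R + theta)^-1 * adsum m.+1 (fun i j =>
    (if i is i'.+1 then b i' j * (i%:R - alpha) else alpha) * H i j +
    (if j is j'.+1 then b i j' * (j'%:R + theta) else 0) * H i j)); last first.
  rewrite -adsumZ; apply: eq_adsum => i j ijm.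
  by rewrite -mulrDl -q_bias_step // ijm // mulrA mulKf.
rewrite adsumD adsumSl adsumSr mul0r addr0.
(* The left sibling of a one-leaf right subtree is a copy of the chain, and
   splits in turn by the induction hypothesis. *)
have -> : H 0%N m.+1 = adsum m (fun i j => b i j *
    E j (fun l => E i (fun r => f (Node (Node l r) (Leaf tt))))).
  transitivity (E m.+1 (fun t => f (Node t (Leaf tt)))); last exact: IHm.
  by apply: eq_expect => l; rewrite /= expect_dirac.
rewrite -!adsumZ -!adsumD -adsumZ; apply: eq_adsum => i j ijm.
by rewrite grow_split // /b; ring.
Qed.

End FirstSplit.

(** * Deleting a uniform leaf *)

Section Deletion.

Lemma isomC s t : isom s t = isom t s.
Proof.
elim: s t => [[]|a IHa b IHb] [[]|c d] //=.
by rewrite !(IHa, IHb); congr orb; rewrite andbC.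
Qed.

Lemma isom_refl s : isom s s.
Proof. by elim: s => //= l -> r ->. Qed.

Lemma isom_trans s t u : isom s t -> isom t u -> isom s u.
Proof.
elim: s t u => [[]|a IHa b IHb] [[]|c d] [[]|e f] //=.
by case/orP=> /andP[h1 h2] /orP[] /andP[h3 h4];
  rewrite (IHa _ _ h1 h3) (IHb _ _ h2 h4) ?orbT
       || rewrite (IHa _ _ h1 h4) (IHb _ _ h2 h3) ?orbT.
Qed.

Variables (R : realFieldType) (alpha theta : R).
Hypothesis theta_gt0 : 0 < theta.
Implicit Types f g : shape -> R.

Local Notation E n := (expect (shape_law alpha theta n)).

Definition invariant f := forall s t, isom s t -> f s = f t.

Definition deletion_sum f (s : shape) : R := \sum_(s' <- deletions s) f s'.

(** The part of the [deletion_sum] of a node that comes from its child [s];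
    deleting a one-leaf child leaves its sibling, whence the value [c]. *)
Definition deletion_branch f (c : R) (s : shape) : R :=
  if s is Leaf _ then c else deletion_sum f s.

Lemma size_deletions (s : shape) : (1 < nleaves s)%N ->
  size (deletions s) = nleaves s.
Proof.
have nleaves_node (a b : shape) : (1 < nleaves (Node a b))%N.
  have pos (t : shape) : (0 < nleaves t)%N by elim: t => //= *; lia.
  by move: (pos a) (pos b) => /=; lia.
elim: s => [//|l IHl r IHr] _ /=; rewrite size_cat; congr addn.
  by case: l IHl => [//|a b] IHl; rewrite size_map IHl.
by case: r IHr => [//|a b] IHr; rewrite size_map IHr.
Qed.

Lemma deletion_sum_node f l r :
  deletion_sum f (Node l r) =
  deletion_branch (fun l' => f (Node l' r)) (f r) l +
  deletion_branch (fun r' => f (Node l r')) (f l) r.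
Proof.
rewrite /deletion_sum big_cat /=; congr (_ + _).
  by case: l => [?|a b]; rewrite ?big_seq1 // big_map.
by case: r => [?|a b]; rewrite ?big_seq1 // big_map.
Qed.

(** The hypothesis has the form of the induction hypothesis in the proof of
    [expect_deletion_sum]. *)
Lemma expect_deletion_branch j f c :
  (forall j', j = j'.+1 -> E j (deletion_sum f) = j.+1%:R * E j' f) ->
  E j (deletion_branch f c) = if j is j'.+1 then j.+1%:R * E j' f else c.
Proof.
case: j => [_|j del_f]; first by rewrite expect_dirac.
by rewrite -del_f //; apply: eq_expect_shape => -[].
Qed.

Lemma adsum_symmetrize m (c T : nat -> nat -> R) :
  (forall i j, T i j = T j i) ->
  adsum m (fun i j => c i j * T i j) =
  adsum m (fun i j => (2^-1 * c i j + 2^-1 * c j i) * T i j).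
Proof.
move=> TC; transitivity (2^-1 * adsum m (fun i j => c i j * T i j) +
                         2^-1 * adsum m (fun i j => c j i * T i j)).
  have -> : adsum m (fun i j => c j i * T i j) =
            adsum m (fun i j => c i j * T i j).
    by rewrite adsumC; apply: eq_adsum => i j _; rewrite TC.
  by lra.
by rewrite -!adsumZ -adsumD; apply: eq_adsum => i j _; ring.
Qed.

(** With [x = i.+1], [y = j.+1], [n = x + y], the left side collects the splits
    of [n + 1] leaves that become [(x, y)] when one leaf of a subtree is deleted.
    Among the [n + 1] deletions, an expected number [2 * q_sym 1 n] hits a
    one-leaf subtree at the first split and leaves a fresh tree with [n] leaves;
    the others must reproduce the first split of a tree with [n] leaves. *)
Definition deletion_stable :=
  forall i j,
    i.+2%:R * q_sym alpha theta i.+2 j.+1 +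
    j.+2%:R * q_sym alpha theta i.+1 j.+2 =
    ((i + j).+3%:R - 2 * q_sym alpha theta 1 (i + j).+2) *
      q_sym alpha theta i.+1 j.+1.

(** A tree with [m.+2] leaves has [m.+2] deletions, so this is sampling
    consistency tested against [f].  Invariance of [f] serves to exchange the two
    subtrees, hence to pass from the biased to the symmetric rule; the induction
    applies to [f] with one subtree held fixed. *)
Lemma expect_deletion_sum m f : deletion_stable -> invariant f ->
  E m.+1 (deletion_sum f) = m.+2%:R * E m f.
Proof.
move=> stable; elim/ltn_ind: m f => m IHm f finv.
pose T i j := E j (fun l => E i (fun r => f (Node l r))).
pose b i j := q_bias alpha theta i.+1 j.+1.
have TC i j : T i j = T j i.
  rewrite /T expectC; apply: eq_expect => r; apply: eq_expect => l.
  by apply: finv; rewrite /= !isom_refl orbT.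
have inv_l r : invariant (fun l => f (Node l r)).
  by move=> s t st; apply: finv; rewrite /= st isom_refl.
have inv_r l : invariant (fun r => f (Node l r)).
  by move=> s t st; apply: finv; rewrite /= st isom_refl.
(* Split at the root, then apply the induction hypothesis in each subtree. *)
have splitE : E m.+1 (deletion_sum f) =
    adsum m (fun i j =>
      b i j * (if j is j'.+1 then j.+1%:R * T i j' else E i f)) +
    adsum m (fun i j =>
      b i j * (if i is i'.+1 then i.+1%:R * T i' j else E j f)).
  rewrite first_split // -adsumD; apply: eq_adsum => i j ijm.
  rewrite -mulrDr; congr (_ * _).
  transitivity (E i (fun r =>
                  E j (deletion_branch (fun l => f (Node l r)) (f r))) +
                E j (fun l =>
                  E i (deletion_branch (fun r => f (Node l r)) (f l)))).
    rewrite expectC -[X in _ = _ + X]expectC -expectD; apply: eq_expect => r.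
    by rewrite -expectD; apply: eq_expect => l; rewrite deletion_sum_node.
  congr (_ + _).
    transitivity (E i (fun r => if j is j'.+1
        then j.+1%:R * E j' (fun l => f (Node l r)) else f r)).
      apply: eq_expect => r; apply: expect_deletion_branch => j' jE.
      by rewrite jE IHm //; lia.
    by case: j ijm => [//|j] _; rewrite expectZ expectC.
  transitivity (E j (fun l => if i is i'.+1
      then i.+1%:R * E i' (fun r => f (Node l r)) else f l)).
    apply: eq_expect => l; apply: expect_deletion_branch => i' iE.
    by rewrite iE IHm //; lia.
  by case: i ijm => [//|i] _; rewrite expectZ.
rewrite {}splitE.
case: m IHm => [|k] IHm.
  by rewrite /adsum !big_ord1 /b q_bias11 //=; ring.
have Ek : E k.+1 f =
    adsum k (fun i j => q_sym alpha theta i.+1 j.+1 * T i j).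
  by rewrite first_split //; apply: (@adsum_symmetrize k b T).
(* Gather the two terms of one-leaf subtrees, and index the others by the
   sizes left after the deletion. *)
rewrite adsumSr [X in _ + X]adsumSl [X in _ + X]addrC addrACA -adsumD addrC.
transitivity (2 * q_sym alpha theta 1 k.+2 * E k.+1 f +
  adsum k (fun i j => (j.+2%:R * b i j.+1 + i.+2%:R * b i.+1 j) * T i j)).
  rewrite /q_sym -/(b _ _) -/(b _ _); congr (_ + _); first by field.
  by apply: eq_adsum => i j _; ring.
rewrite (adsum_symmetrize _ _ TC) Ek -!adsumZ -adsumD.
apply: eq_adsum => i j ijk.
have := stable i j; rewrite ijk.
rewrite [q_sym _ _ i.+2 _]/q_sym [q_sym _ _ i.+1 j.+2]/q_sym /b => st.
have -> : (k.+3%:R * (q_sym alpha theta i.+1 j.+1 * T i j)) =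
  2 * q_sym alpha theta 1 k.+2 * (q_sym alpha theta i.+1 j.+1 * T i j) +
  (k.+3%:R - 2 * q_sym alpha theta 1 k.+2) *
    q_sym alpha theta i.+1 j.+1 * T i j.
  by ring.
by rewrite -st; ring.
Qed.

(** Sampling consistency compares the laws on isomorphism classes, whose
    indicators are invariant functions. *)
Theorem deletion_stable_consistent :
  deletion_stable -> weakly_sampling_consistent alpha theta.
Proof.
move=> stable [//|n] _ s.
pose f (t : shape) : R := (isom s t)%:R.
have finv : invariant f.
  move=> t u tu; congr (nat_of_bool _)%:R.
  apply/idP/idP => [st|su]; first exact: isom_trans st tu.
  by apply: isom_trans su _; rewrite isomC.
rewrite !prob_expect /leaf_deleted_law expect_bind !unlabelled_law_shape.
transitivity (E n.+1 (fun t => n.+2%:R^-1 * deletion_sum f t)).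
  by rewrite expectZ expect_deletion_sum // mulKf // pnatr_eq0.
apply: eq_expect_shape => t tn.
by rewrite expect_uniform size_deletions tn.
Qed.

End Deletion.

Unset Implicit Arguments.
Set Strict Implicit.
Set Printing Implicit Defensive.

(** * The two symmetric rules and sampling consistency *)

Theorem lemma12 (R : realType) (alpha : R) (alpha_gt0 : 0 < alpha)
    (alpha_lt1 : alpha < 1) :
  (forall x y : nat, (1 <= x)%N -> (1 <= y)%N ->
     q_sym alpha (1 - alpha) x y = q_sym alpha (2 - alpha) x y)
  /\ weakly_sampling_consistent alpha (2 - alpha).
Proof.
split=> [[//|i] [//|j] _ _|]; first by rewrite q_sym_one_sub // q_sym_two_sub.
apply: deletion_stable_consistent => [|i j]; first by lra.
by rewrite !q_sym_two_sub //; apply: ford_split_deletion.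
Qed.
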